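(* There exist absolute constants $c, C > 0$ such that for every integer $n \geq 1$ and every real $\epsilon > 0$, setting $m = \lfloor e^{c n \epsilon^2} \rfloor$, there exist reflections $X_1, Z_1, \ldots, X_m, Z_m$ on a $2^n$-dimensional complex Hilbert space such that $\{X_j, Z_j\} = 0$ for all $j \in \{1,\ldots,m\}$, and $\|[S_i, T_j]\| \leq C \epsilon$ for all $i \neq j$ in $\{1,\ldots,m\}$ and all choices $S, T \in \{X, Z\}$.
   Context: A reflection is a Hermitian operator that squares to the identity. $[A,B] = AB - BA$, $\{A,B\} = AB + BA$, and $\|\cdot\|$ is the operator norm. ''$S_i$ for $S \in \{X,Z\}$'' means $X_i$ or $Z_i$ (the letter $S$ is replaced by $X$ or $Z$). *)

(* Defs.v *)
From HB Require Import structures.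
From mathcomp Require Import all_boot all_order all_algebra.
From mathcomp Require Import complex.
From mathcomp Require Import all_classical all_reals all_analysis.

Set Implicit Arguments.
Unset Strict Implicit.
Unset Printing Implicit Defensive.

Import Order.TTheory GRing.Theory Num.Theory.

Local Open Scope ring_scope.
Local Open Scope classical_set_scope.
Local Open Scope complex_scope.
Local Open Scope sesquilinear_scope.

(* Operators on the Hilbert space C^d are d x d matrices acting on column
   vectors; [A ^t*] is the conjugate transpose, i.e. the adjoint. *)
Definition reflection (R : realType) (d : nat) (A : 'M[R[i]]_d) : Prop :=
  A ^t* = A /\ A *m A = 1%:M.

Definition commutator (R : realType) (d : nat) (A B : 'M[R[i]]_d) :
    'M[R[i]]_d :=
  A *m B - B *m A.

Definition anticommutator (R : realType) (d : nat) (A B : 'M[R[i]]_d) :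
    'M[R[i]]_d :=
  A *m B + B *m A.

Definition l2norm (R : realType) (d : nat) (v : 'cV[R[i]]_d) : R :=
  Num.sqrt (\sum_(k < d) Normc.normc (v k 0) ^+ 2).

(* [sup] is the real-valued supremum (0 by convention on unbounded sets); the
   set below is nonempty and bounded for every matrix [A]. *)
Definition opnorm (R : realType) (d : nat) (A : 'M[R[i]]_d) : R :=
  sup [set l2norm (A *m v) | v in [set v : 'cV[R[i]]_d | l2norm v <= 1]].

(* Main.v *)
(* Let [g 0], [g 1], [g 2] be three mutually anticommuting Clifford maps of
   [R^N], [N = (2n + 1) / 3], built from the [2n + 1] gamma matrices of size
   [2^n]; thus [{g s x, g t y} = 2 delta_st <x, y>]. For unit vectors [u_j] the
   operators [X_j = i g0(u_j) g1(u_j)] and [Z_j = i g0(u_j) g2(u_j)] are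
   anticommuting reflections, and for [i != j] the commutators are sums of four
   terms [2 delta <u_i, u_j> P Q] with [P], [Q] reflections, hence of norm at
   most [8 |<u_i, u_j>|]. By Chernoff's bound and a greedy choice among the
   sign vectors, exponentially many (in [n eps^2]) unit vectors have pairwise
   inner products at most [eps]. *)

Require Import Defs.
From mathcomp Require Import all_boot all_order all_algebra.
From mathcomp Require Import complex.
From mathcomp Require Import all_classical all_reals all_analysis.
From mathcomp Require Import ring lra zify.

Import Order.TTheory GRing.Theory Num.Theory.

Local Open Scope ring_scope.
Local Open Scope complex_scope.
Local Open Scope sesquilinear_scope.

(** * Greedy selection in a graph of bounded degree *)

(** Elements are picked one at a time: the at most [m.-1] earlier picks exclude at most [m.-1 * B]
    elements, so a candidate always remains. *)
Lemma greedy_independent (T : finType) (bad : rel T) (B m : nat) :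
  symmetric bad -> (forall x, (#|bad x| <= B)%N) -> (m.-1 * B < #|T|)%N ->
  exists f : 'I_m -> T, forall i j, i != j -> ~~ bad (f i) (f j).
Proof.
move=> bad_sym card_bad card_T.
(* Indexing by all naturals lets the induction change a single value; the case [m = 0] then needs an
   element of [T], supplied by the strict cardinality bound. *)
have [f fP] : exists f : nat -> T,
    forall i j, (i < j < m)%N -> ~~ bad (f i) (f j).
  elim: m card_T => [|m IHm] /= card_T.
    have /card_gt0P[x _] : (0 < #|T|)%N by [].
    by exists (fun=> x) => i j; rewrite ltn0 andbF.
  have [|f fP] := IHm.
    by apply: leq_ltn_trans card_T; rewrite leq_mul2r leq_pred orbT.
  pose A := \bigcup_(i < m) [set y | bad (f i) y]%SET.
  have card_A : (#|A| <= m * B)%N.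
    rewrite -[m in leqRHS]card_ord -sum_nat_const /A.
    elim/big_ind2: _ => [|a u b v au bv|i _]; first by rewrite cards0.
      by rewrite (leq_trans (leq_card_setU a b)) // leq_add.
    by rewrite cardsE.
  have /card_gt0P[y] : (0 < #|~: A|)%N by rewrite cardsCs finset.setCK subn_gt0 (leq_ltn_trans card_A).
  rewrite inE => /bigcupP yA.
  exists (fun k => if k == m then y else f k) => i j /andP[ij].
  rewrite ltnS leq_eqVlt => /orP[/eqP jm|jm].
    rewrite jm eqxx ltn_eqF -?jm //; apply/negP => bad_i; apply: yA.
    by rewrite jm in ij; exists (Ordinal ij); rewrite ?inE.
  by rewrite !ltn_eqF ?(ltn_trans ij) ?fP ?ij.
exists (fun i => f i) => i j; rewrite -val_eqE neq_ltn => /orP[ij|ji].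
  by apply: fP; rewrite ij /=.
by rewrite bad_sym; apply: fP; rewrite ji /=.
Qed.

(** * Chernoff bound for sign vectors *)

(** For [x >= 1/2] one has [x <= 2 x^2]. For smaller [x], [exp y <= 1 / (1 - y)] bounds the sum by
    [2 / (1 - x^2)], and [1 / (1 - x^2) <= 1 + 2 x^2]. *)
Lemma expRD_oppr_le (R : realType) (x : R) :
  expR x + expR (- x) <= 2 * expR (2 * x ^+ 2).
Proof.
wlog x_ge0 : x / 0 <= x => [hwlog|].
  case: (lerP 0 x) => [|/ltW x_le0]; first exact: hwlog.
  by have := hwlog (- x); rewrite opprK sqrrN addrC oppr_ge0; apply.
have [x_big|x_small] := lerP (1 / 2) x.
  have e1 : expR x <= expR (2 * x ^+ 2) by rewrite ler_expR; nra.
  have e2 : expR (- x) <= expR (2 * x ^+ 2) by rewrite ler_expR; nra.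
  lra.
have pos (y : R) : `|y| < 1 -> expR y <= (1 - y)^-1.
  move=> /ltr_normlP[y1 y2].
  rewrite -[leLHS]invrK lef_pV2 ?posrE ?invr_gt0 ?expR_gt0 ?subr_gt0 //.
  by rewrite -expRN; exact: expR_ge1Dx.
have e1 := pos x; have e2 := pos (- x); have e3 := expR_ge1Dx (2 * x ^+ 2).
rewrite normrN ger0_norm // in e1 e2.
apply: (@le_trans _ _ ((1 - x)^-1 + (1 - - x)^-1)); first by apply: lerD; lra.
have -> : (1 - x)^-1 + (1 - - x)^-1 = 2 * (1 - x ^+ 2)^-1.
  by field; apply/and3P; split; apply/eqP; nra.
have x2 : x ^+ 2 <= 1 / 4 by nra.
by rewrite ler_pM2l // (le_trans _ e3) // -[leLHS]mul1r ler_pdivrMr;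
  have := sqr_ge0 x; nra.
Qed.

(** Signs are stored as booleans so that the sign vectors form a finite type. *)
Definition sign_dot (R : realType) (N : nat) (x y : {ffun 'I_N -> bool}) : R :=
  \sum_(k < N) (-1) ^+ x k * (-1) ^+ y k.

(** This is the moment generating function up to the factor [2 ^ N]: the sum factors over the
    coordinates, and either sign of [x k] gives the same factor. *)
Lemma sum_expR_sign_dot (R : realType) (N : nat) (x : {ffun 'I_N -> bool})
    (a : R) :
  \sum_y expR (a * sign_dot R N x y) = (expR a + expR (- a)) ^+ N.
Proof.
under eq_bigr do rewrite mulr_sumr expR_sum.
rewrite -(bigA_distr_bigA (fun k (b : bool) => expR (a * ((-1) ^+ x k * (-1) ^+ b)))).
rewrite -[N in RHS]card_ord -prodr_const; apply: eq_bigr => k _.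
rewrite big_bool.
by case: (x k); rewrite /= !(mul1r, mulr1, mulrN1, opprK) // addrC.
Qed.

(* Chernoff's bound with the nearly optimal parameter [t / 4]. *)
Lemma card_sign_dot_gt (R : realType) (N : nat) (t : R)
    (x : {ffun 'I_N -> bool}) : 0 < t ->
  #|[pred y | t * N%:R < `|sign_dot R N x y|]|%:R * expR (t ^+ 2 / 8 * N%:R)
    <= 2 * (2 ^ N)%:R.
Proof.
move=> t_gt0; set E := [pred y | _]; pose a := t / 4.
have a_gt0 : 0 < a by rewrite divr_gt0.
(* Markov's inequality; adding the sums for [a] and [- a] covers both signs of the inner product. *)
have sum_le : #|E|%:R * expR (a * (t * N%:R)) <=
    2 * (expR a + expR (- a)) ^+ N.
  rewrite [X in _ <= X](_ : _ = \sum_y (expR (a * sign_dot R N x y) +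
      expR (- a * sign_dot R N x y))); last first.
    by rewrite big_split /= !sum_expR_sign_dot opprK [expR (- a) + _]addrC; ring.
  rewrite mulr_natl -sumr_const [leRHS](bigID (mem E)) /=.
  rewrite -[leLHS]addr0; apply: lerD; last first.
    by apply: sumr_ge0 => y _; rewrite addr_ge0 ?expR_ge0.
  apply: ler_sum => y; rewrite inE => /ltW tN.
  set s := sign_dot R N x y in tN *.
  have [s0|s0] := lerP 0 s.
    rewrite -[leLHS]addr0 lerD ?expR_ge0 // ler_expR ler_pM2l //.
    by rewrite (ger0_norm s0) in tN.
  rewrite -[leLHS]add0r lerD ?expR_ge0 // ler_expR mulNr -mulrN ler_pM2l //.
  by rewrite (ltr0_norm s0) in tN.
have pow_le : (expR a + expR (- a)) ^+ N <=
    (2 ^ N)%:R * expR (t ^+ 2 / 8 * N%:R).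
  rewrite natrX expRM_natr -exprMn lerXn2r ?nnegrE ?addr_ge0 ?mulr_ge0 ?expR_ge0 //.
  by rewrite (le_trans (expRD_oppr_le _ a)) // ler_pM2l // ler_expR /a; nra.
(* As [a t = t^2 / 4], the Markov weight is the square of the factor in [pow_le], so one copy
   cancels. *)
have eE : expR (a * (t * N%:R)) =
    expR (t ^+ 2 / 8 * N%:R) * expR (t ^+ 2 / 8 * N%:R).
  by rewrite -expRD; congr expR; rewrite /a; field.
rewrite -(ler_pM2r (expR_gt0 (t ^+ 2 / 8 * N%:R))) -[leLHS]mulrA -eE.
by apply: (le_trans sum_le); rewrite -[leRHS]mulrA ler_pM2l.
Qed.

(** * Gamma matrices *)

Lemma mulii (R : realType) : 'i * 'i = -1 :> R[i].
Proof. by rewrite -expr2 sqr_i. Qed.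

Lemma conji (R : realType) : Num.conj ('i : R[i]) = - 'i.
Proof. by apply/eqP; rewrite eq_complex /= oppr0 !eqxx. Qed.

Lemma anticommutatorC (R : realType) (d : nat) (A B : 'M[R[i]]_d) :
  anticommutator A B = anticommutator B A.
Proof. by rewrite /anticommutator addrC. Qed.

(** Each induction step doubles the size and adds two generators, by tensoring with the Pauli
    matrices: [sigma_x] and [sigma_y] with the identity, [sigma_z] with each old generator. *)
Lemma clifford_generators (R : realType) (n : nat) :
  exists g : nat -> 'M[R[i]]_(2 ^ n), (forall j, (g j) ^t* = g j) /\
    forall j k, (j <= n.*2)%N -> (k <= n.*2)%N ->
      anticommutator (g j) (g k) = ((j == k)%:R *+ 2)%:M.
Proof.
(* A size known only up to an equation can be rewritten as [d + d], the form that block matrices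
   require. *)
suff gen d : d = (2 ^ n)%N -> exists g : nat -> 'M[R[i]]_d,
    (forall j, (g j) ^t* = g j) /\
    forall j k, (j <= n.*2)%N -> (k <= n.*2)%N ->
      anticommutator (g j) (g k) = ((j == k)%:R *+ 2)%:M by exact: gen.
elim: n d => [|n IHn] d.
  move=> ->; exists (fun=> 1%:M).
  split=> [j|[|//] [|//] _ _]; first by rewrite trmx1 map_mx1.
  by rewrite /anticommutator mulmx1 -raddfD.
rewrite expnS mul2n -addnn; have [g [gH gA]] := IHn _ erefl => ->.
move: (2 ^ n)%N g gH gA => {IHn}d g gH gA.
pose h k : 'M[R[i]]_(d + d) := match k with
  | 0 => block_mx 0 1%:M 1%:M 0
  | 1 => block_mx 0 (- 'i)%:M 'i%:M 0
  | k.+2 => block_mx (g k) 0 0 (- g k)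
  end.
exists h; split=> [[|[|k]]|].
- by rewrite /= tr_block_mx map_block_mx !trmx0 !trmx1 !map_mx0 !map_mx1.
- rewrite /= tr_block_mx map_block_mx !trmx0 !tr_scalar_mx !map_mx0.
  by rewrite !map_scalar_mx /= rmorphN /= conji opprK.
- by rewrite /= tr_block_mx map_block_mx !trmx0 !map_mx0 !linearN /= map_mxN !gH.
have hA j k : (j <= k)%N -> (k <= n.+1.*2)%N ->
    anticommutator (h j) (h k) = ((j == k)%:R *+ 2)%:M.
  case: j => [|[|j]]; case: k => [|[|k]] //= jk kn;
    rewrite /anticommutator !mulmx_block add_block_mx
      !(mulmx0, mul0mx, mulmx1, mul1mx, addr0, add0r, mulmxN, mulNmx,
        mul_mx_scalar, mul_scalar_mx, scale_scalar_mx, mulNr, mulrN, mulii, opprK);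
    rewrite ?eqSS [RHS]scalar_mx_block ?mul0rn ?scalerN ?scaleNr;
    rewrite ?mulr1n ?mulr2n ?[(1 + 1)%:M]raddfD /= ?raddfN /= ?subrr ?addNr ?oppr0 ?addr0 ?raddf0 //.
  by rewrite -mulr2n; congr block_mx; [apply: gA | apply: gA]; lia.
move=> j k jn kn; have [jk|kj] := leqP j k; first exact: hA.
by rewrite anticommutatorC eq_sym hA // ltnW.
Qed.

(** * Norm estimates *)

Lemma l2norm_sqr (R : realType) (d : nat) (v : 'cV[R[i]]_d) :
  (l2norm v ^+ 2)%:C = (v ^t* *m v) 0 0.
Proof.
rewrite /l2norm sqr_sqrtr ?sumr_ge0 // => [|k _]; last exact: sqr_ge0.
rewrite mxE rmorph_sum; apply: eq_bigr => k _; rewrite !mxE.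
case: (v k 0) => a b; rewrite sqr_sqrtr ?addr_ge0 ?sqr_ge0 //.
by apply/eqP; rewrite eq_complex /=; apply/andP; split; apply/eqP; ring.
Qed.

Lemma l2norm_reflection (R : realType) (d : nat) (A : 'M[R[i]]_d)
    (v : 'cV[R[i]]_d) : reflection A -> l2norm (A *m v) = l2norm v.
Proof.
move=> [AH AA]; apply/eqP; rewrite -(eqrXn2 (n := 2)) ?sqrtr_ge0 //.
apply/eqP/(@complexI R); rewrite !l2norm_sqr trmx_mul map_mxM /= AH.
by rewrite -mulmxA (mulmxA A) AA mul1mx.
Qed.

Lemma l2normZ (R : realType) (d : nat) (a : R) (v : 'cV[R[i]]_d) :
  l2norm (a%:C *: v) = `|a| * l2norm v.
Proof.
rewrite /l2norm -sqrtr_sqr -sqrtrM ?sqr_ge0 //; congr Num.sqrt.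
rewrite mulr_sumr; apply: eq_bigr => k _.
rewrite mxE Normc.normcM exprMn; congr (_ * _).
by rewrite /= expr0n addr0 sqr_sqrtr ?sqr_ge0.
Qed.

(** A triangle inequality for a common bound follows from [|u + v|^2 <= 2 (|u|^2 + |v|^2)], checked
    coordinatewise without Cauchy-Schwarz. *)
Lemma l2normD_le (R : realType) (d : nat) (r : R) (u v : 'cV[R[i]]_d) :
  l2norm u <= r -> l2norm v <= r -> l2norm (u + v) <= 2 * r.
Proof.
have l2norm_ge0 (w : 'cV[R[i]]_d) : 0 <= l2norm w by exact: sqrtr_ge0.
move=> ur vr; have u0 := l2norm_ge0 u; have v0 := l2norm_ge0 v.
suff : l2norm (u + v) ^+ 2 <= 2 * (l2norm u ^+ 2 + l2norm v ^+ 2).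
  by have := l2norm_ge0 (u + v); nra.
have sum_ge0 (w : 'cV[R[i]]_d) : 0 <= \sum_k Normc.normc (w k 0) ^+ 2.
  by apply: sumr_ge0 => k _; exact: sqr_ge0.
rewrite /l2norm !sqr_sqrtr // -big_split mulr_sumr; apply: ler_sum => k _.
rewrite mxE; case: (u k 0) (v k 0) => a b [a' b'] /=.
rewrite !sqr_sqrtr ?addr_ge0 ?sqr_ge0 //.
by have := sqr_ge0 (a - a'); have := sqr_ge0 (b - b'); nra.
Qed.

Lemma opnorm_le (R : realType) (d : nat) (A : 'M[R[i]]_d) (r : R) :
  (forall v, l2norm v <= 1 -> l2norm (A *m v) <= r) -> opnorm A <= r.
Proof.
move=> Ar; apply: ge_sup => [|_ [v v1 <-]]; last exact: Ar.
exists (l2norm (A *m 0)), 0 => //=; rewrite /l2norm big1 ?sqrtr0 // => k _.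
by rewrite mxE Normc.normc0 expr0n.
Qed.

(** * Commutators of products of reflections *)

(** Moving [a * b] past [c * d] takes four swaps of neighbours; each costs an anticommutator and a
    sign, and the four signs cancel. *)
Lemma commutator_mulE (A : pzRingType) (a b c d : A) :
  a * b * (c * d) - c * d * (a * b) =
  a * (b * c + c * b) * d - a * c * (b * d + d * b) +
  (a * c + c * a) * (d * b) - c * (a * d + d * a) * b.
Proof.
rewrite !mulrDr !mulrDl !mulrA !opprD !addrA addrK.
by rewrite subrK addrK.
Qed.

Lemma opnorm_commutator_bilinear (R : realType) (d : nat) (eps : R)
    (A B C D : 'M[R[i]]_d) (ac ad bc bd : R) :
  reflection A -> reflection B -> reflection C -> reflection D ->
  anticommutator A C = (ac *+ 2)%:C%:M -> anticommutator A D = (ad *+ 2)%:C%:M ->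
  anticommutator B C = (bc *+ 2)%:C%:M -> anticommutator B D = (bd *+ 2)%:C%:M ->
  `|ac| <= eps -> `|ad| <= eps -> `|bc| <= eps -> `|bd| <= eps ->
  opnorm (commutator ('i *: (A *m B)) ('i *: (C *m D))) <= 8 * eps.
Proof.
move=> rA rB rC rD AC AD BC BD ac_le ad_le bc_le bd_le.
have term p P Q v : `|p| <= eps -> reflection P -> reflection Q ->
    l2norm v <= 1 -> l2norm ((p *+ 2)%:C *: (P *m Q) *m v) <= 2 * eps.
  move=> p_le rP rQ v1; rewrite -scalemxAl l2normZ -mulmxA.
  rewrite !l2norm_reflection // normrMn.
  have := normr_ge0 p; have : 0 <= l2norm v by exact: sqrtr_ge0.
  nra.
(* The signs absorb ['i * 'i = -1]; the four terms are bracketed in pairs so that [l2normD_le]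
   applies at both levels. *)
have -> : commutator ('i *: (A *m B)) ('i *: (C *m D)) =
    (- bc *+ 2)%:C *: (A *m D) + (bd *+ 2)%:C *: (A *m C) +
    ((- ac *+ 2)%:C *: (D *m B) + (ad *+ 2)%:C *: (C *m B)).
  rewrite /commutator -!scalemxAl -!scalemxAr !scalerA -scalerBr mulii.
  have := @commutator_mulE 'M[R[i]]_d A B C D; rewrite /GRing.mul /= => ->.
  move: AC AD BC BD; rewrite /anticommutator => -> -> -> ->.
  rewrite !mul_mx_scalar mul_scalar_mx -!scalemxAl scaleN1r !mulNrn !rmorphN /= !scaleNr.
  by rewrite !opprD !opprK !addrA.
apply: opnorm_le => v v1; rewrite !mulmxDl.
have -> : 8 * eps = 2 * (2 * (2 * eps)) by ring.
by do !apply: l2normD_le; apply: term; rewrite ?normrN.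
Qed.

(** * Clifford maps and the reflections built from them *)

Lemma anticommutator_sum (R : realType) (d N : nat)
    (A B : 'I_N -> 'M[R[i]]_d) (x y : 'I_N -> R[i]) :
  anticommutator (\sum_k x k *: A k) (\sum_k y k *: B k) =
  \sum_k \sum_l (x k * y l) *: anticommutator (A k) (B l).
Proof.
rewrite /anticommutator !mulmx_suml.
under [X in _ + X]eq_bigr do rewrite mulmx_sumr.
rewrite [X in _ + X]exchange_big -big_split; apply: eq_bigr => k _ /=.
rewrite mulmx_sumr -big_split; apply: eq_bigr => l _ /=.
by rewrite -!scalemxAl -!scalemxAr !scalerA scalerDr (mulrC (y l)).
Qed.

(** Coordinate [k] of map [s] uses generator [3 * k + s]. Distinct pairs [(s, k)] get distinct
    generators, so only the terms with [k = l] and [s = t] survive. *)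
Lemma clifford_maps (R : realType) (n N : nat) : (3 * N <= n.*2.+1)%N ->
  exists g : 'I_3 -> ('I_N -> R) -> 'M[R[i]]_(2 ^ n),
    (forall s x, (g s x) ^t* = g s x) /\
    forall s t x y, anticommutator (g s x) (g t y) =
      (((s == t)%:R * \sum_k x k * y k) *+ 2)%:C%:M.
Proof.
move=> Nn; have [h [hH hA]] := clifford_generators R n.
exists (fun s x => \sum_(k < N) (x k)%:C *: h (3 * k + s)%N); split=> [s x|s t x y].
  rewrite !raddf_sum /=; apply: eq_bigr => k _.
  rewrite linearZ /= map_mxZ hH; congr (_ *: _); exact: conjc_real.
rewrite anticommutator_sum mulr_sumr -sumrMnl rmorph_sum /= raddf_sum.
apply: eq_bigr => k _; rewrite (bigD1 k) //= [X in _ + X]big1 => [|l lk].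
  rewrite hA ?addr0; try by have := ltn_ord k; have := ltn_ord s;
    have := ltn_ord t; lia.
  rewrite scale_scalar_mx eqn_add2l -rmorphM /=; congr _%:M.
  rewrite val_eqE; case: (s == t); rewrite ?mul1r ?mul0r ?mul0rn ?mulr0 //=.
  by rewrite rmorphMn /= mulr_natr.
have -> : anticommutator (h (3 * k + s)%N) (h (3 * l + t)%N) = 0.
  rewrite hA; try by have := ltn_ord k; have := ltn_ord l; have := ltn_ord s;
    have := ltn_ord t; lia.
  have /negPf -> : (3 * k + s != 3 * l + t)%N.
    by move: lk; rewrite -val_eqE /=; have := ltn_ord s; have := ltn_ord t; lia.
  by rewrite mul0rn raddf0.
by rewrite scaler0.
Qed.

Lemma reflection_of_square (R : realType) (d : nat) (A : 'M[R[i]]_d) :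
  A ^t* = A -> anticommutator A A = (1 *+ 2)%:C%:M -> reflection A.
Proof.
rewrite /anticommutator -mulr2n rmorphMn raddfMn => AH AA; split=> //.
have two0 : 2%:R != 0 :> R[i] by rewrite pnatr_eq0.
by apply: (scalerI two0); rewrite !scaler_nat.
Qed.

(** The product [A B] is skew-Hermitian with square [-1]; the factor ['i] corrects both. *)
Lemma reflection_mul (R : realType) (d : nat) (A B : 'M[R[i]]_d) :
  reflection A -> reflection B -> anticommutator A B = 0 ->
  reflection ('i *: (A *m B)).
Proof.
move=> [AH AA] [BH BB] /eqP; rewrite addr_eq0 => /eqP AB; split.
  rewrite linearZ /= map_mxZ trmx_mul map_mxM AH BH /= conji.
  by rewrite AB scalerN scaleNr.
rewrite -scalemxAl -scalemxAr scalerA {2}AB mulmxN scalerN -scaleNr.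
rewrite mulmxA -(mulmxA A) BB mulmx1 AA.
by rewrite mulii opprK scale1r.
Qed.

(** Since [(A B)(A C) = - B C], the factors ['i] reduce the anticommutator to that of [B] and
    [C]. *)
Lemma anticommutator_mul (R : realType) (d : nat) (A B C : 'M[R[i]]_d) :
  reflection A -> anticommutator A B = 0 -> anticommutator A C = 0 ->
  anticommutator B C = 0 ->
  anticommutator ('i *: (A *m B)) ('i *: (A *m C)) = 0.
Proof.
move=> [_ AA] /eqP; rewrite addr_eq0 => /eqP AB /eqP.
rewrite addr_eq0 => /eqP AC BC.
rewrite /anticommutator -!scalemxAl -!scalemxAr !scalerA -scalerDr.
rewrite {1}AB {2}AC !mulNmx !mulmxA -!(mulmxA _ A A) AA !mulmx1.
by rewrite -opprD -/(anticommutator B C) BC oppr0 scaler0.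
Qed.

(** * Nearly orthogonal unit vectors *)

Lemma nearly_orthogonal_family (R : realType) (n m N : nat) (eps : R) :
  0 < eps -> (n <= 2 * N)%N -> (0 < N)%N ->
  m%:R <= expR (32^-1 * n%:R * eps ^+ 2) ->
  exists u : 'I_m -> 'I_N -> R, (forall j, \sum_k u j k * u j k = 1) /\
    forall i j, i != j -> `|\sum_k u i k * u j k| <= eps.
Proof.
move=> eps0 nN N0 m_le.
pose T := {ffun 'I_N -> bool}.
pose bad (x y : T) := eps * N%:R < `|sign_dot R N x y|.
have cardT : #|T| = (2 ^ N)%N by rewrite card_ffun card_bool card_ord.
pose B := (\max_(x : T) #|bad x|)%N.
have B_le : B%:R * expR (eps ^+ 2 / 8 * N%:R) <= 2 * (2 ^ N)%:R.
  rewrite /B; elim/big_ind: _ => [|a b ha hb|x _]; first by rewrite mul0r mulr_ge0.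
    by rewrite /maxn; case: ifP.
  exact: card_sign_dot_gt.
have [|||f fP] := @greedy_independent T bad B m.
- by move=> x y; rewrite /bad /sign_dot; under eq_bigr do rewrite mulrC.
- by move=> x; apply: (leq_bigmax (F := fun x => #|bad x|)).
- rewrite cardT; case: m m_le => [|[|m]] m_le; rewrite ?mul0n ?expn_gt0 //=.
  rewrite -(ltr_nat R) natrM -(ltr_pM2r (expR_gt0 (eps ^+ 2 / 8 * N%:R))).
  set E := expR (32^-1 * n%:R * eps ^+ 2) in m_le.
  have m1 : 1 <= m.+1%:R :> R by rewrite ler1n.
  rewrite -natr1 in m_le.
  (* The constant [32^-1] comes from here, using [n <= 2 N]. With [k] earlier picks and
     [k + 1 <= E], the factor 2 in [B_le] is absorbed by [2 k < (k + 1)^2 <= E^2]. *)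
  have EE : E * E <= expR (eps ^+ 2 / 8 * N%:R).
    rewrite -expRD ler_expR; have : n%:R <= 2 * N%:R :> R by rewrite -natrM ler_nat.
    by have := sqr_ge0 eps; nra.
  have p0 : 0 < (2 ^ N)%:R :> R by rewrite ltr0n expn_gt0.
  rewrite -mulrA; apply: (@le_lt_trans _ _ (m.+1%:R * (2 * (2 ^ N)%:R))).
    by rewrite ler_wpM2l.
  by rewrite mulrA [ltRHS]mulrC ltr_pM2r //; nra.
have N0' : 0 < N%:R :> R by rewrite ltr0n.
have dotE i j : \sum_k ((-1) ^+ f i k / Num.sqrt N%:R) *
    ((-1) ^+ f j k / Num.sqrt N%:R) = sign_dot R N (f i) (f j) / N%:R.
  rewrite mulr_suml; apply: eq_bigr => k _.
  by rewrite mulrACA -invfM -expr2 sqr_sqrtr // ltW.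
exists (fun j k => (-1) ^+ f j k / Num.sqrt N%:R); split=> [j|i j ij].
  rewrite dotE /sign_dot (eq_bigr (fun=> 1)) => [|k _].
    by rewrite sumr_const card_ord divff // gt_eqF.
  by rewrite -expr2 sqrr_sign.
rewrite dotE normrM normfV (gtr0_norm N0') ler_pdivrMr // leNgt.
exact: fP.
Qed.

(** * Assembling the reflections *)

Theorem theorem3p1 (R : realType) :
  exists c C : R, [/\ 0 < c, 0 < C &
    forall (n : nat) (eps : R), (1 <= n)%N -> 0 < eps ->
    let m := Num.truncn (expR (c * n%:R * eps ^+ 2)) in
    exists X Z : 'I_m -> 'M[R[i]]_(2 ^ n),
      [/\ forall j : 'I_m, reflection (X j) /\ reflection (Z j),
          forall j : 'I_m, anticommutator (X j) (Z j) = 0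
        & forall i j : 'I_m, i != j ->
          forall S T : 'I_m -> 'M[R[i]]_(2 ^ n),
            S = X \/ S = Z -> T = X \/ T = Z ->
            opnorm (commutator (S i) (T j)) <= C * eps]].
Proof.
exists 32^-1, 8; split=> // n eps n1 eps0.
move: (Num.truncn _) (truncn_le (expR (32^-1 * n%:R * eps ^+ 2))) => m.
rewrite expR_ge0 => m_le.
(* Three maps share [2n + 1] generators; [n >= 1] ensures both [N > 0] and [n <= 2 N]. *)
pose N := (n.*2.+1 %/ 3)%N.
have [||u [u1 uo]] := @nearly_orthogonal_family R n m N eps eps0 _ _ m_le.
- by rewrite /N; lia.
- by rewrite /N; lia.
have [|g [gH gA]] := @clifford_maps R n N; first by rewrite /N; lia.
have gR s j : reflection (g s (u j)).
  by apply: reflection_of_square; rewrite ?gA ?gH // eqxx u1 mul1r.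
have g0 (s t : 'I_3) j : s != t -> anticommutator (g s (u j)) (g t (u j)) = 0.
  by move=> /negPf st; rewrite gA st mul0r mul0rn !raddf0.
have dot_le (s t : 'I_3) i j : i != j ->
    `|(s == t)%:R * \sum_k u i k * u j k| <= eps.
  by move=> ij; case: (s == t); rewrite ?mul1r ?mul0r ?uo // normr0 ltW.
(* The common factor [g 0 (u j)] makes [P 1 j] and [P 2 j] anticommute, and one estimate in [s] and
   [t] covers all four choices of [S] and [T]. *)
pose P s j := 'i *: (g 0 (u j) *m g s (u j)).
exists (P 1), (P 2%:R); split=> [j|j|i j ij S T].
- by split; apply: reflection_mul; rewrite ?g0.
- by apply: anticommutator_mul; rewrite ?g0.
move=> HS HT.
have [s ->] : exists s, S = P s by case: HS => ->; [exists 1 | exists 2%:R].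
have [t ->] : exists t, T = P t by case: HT => ->; [exists 1 | exists 2%:R].
by apply: opnorm_commutator_bilinear; rewrite ?gA; try exact: gR;
  try reflexivity; exact: dot_le.
Qed.
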